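(* Let $(L,m)$ be a quasi-local C-lattice and let $x\in L$ be proper. Then $x$ is an OA-element if and only if $x$ is a prime element or $m^2\leq x<m$.
   Context: A multiplicative lattice is a set $L$ with a commutative associative multiplication and a partial order $\leq$ such that $(L,\leq)$ is a complete lattice with greatest element $1$ and least element $0$, and such that $1x=x$ and $x(\bigvee E)=\bigvee\{xe\mid e\in E\}$ for all $x\in L$ and $E\subseteq L$. An element $a\in L$ is compact if for each $F\subseteq L$ with $a\leq\bigvee F$ there is a finite $E\subseteq F$ with $a\leq\bigvee E$. A subset is multiplicatively closed if it contains $1$ and is closed under products. $L$ is a C-lattice if there is a multiplicatively closed subset $C\subseteq L$ of compact elements such that every element of $L$ is a join of elements of $C$. An element $a$ is proper if $a<1$. A proper element $m$ is maximal if $m<x\leq 1$ implies $x=1$. A proper element $p$ is prime if for all $a,b\in L$, $ab\leq p$ implies $a\leq p$ or $b\leq p$. $L$ is quasi-local if $1$ is compact and $L$ has a unique maximal element; $(L,m)$ quasi-local means that $m$ is this maximal element. A proper element $x$ of a C-lattice $L$ is an OA-element ($1$-absorbing prime element) if for all $a,b,c\in L\setminus\{1\}$, $abc\leq x$ implies $ab\leq x$ or $c\leq x$. *)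

(* Defs.v *)
From HB Require Import structures.
From mathcomp Require Import all_boot all_order.
From mathcomp Require Import boolp classical_sets functions cardinality.

Set Implicit Arguments.
Unset Strict Implicit.
Unset Printing Implicit Defensive.

Import Order.TTheory.
Local Open Scope classical_set_scope.
Local Open Scope group_scope.
Local Open Scope order_scope.

HB.mixin Record TBLattice_isComplete d L of Order.TBLattice d L := {
  supremums_neq0 : forall E : set L, supremums E !=set0;
  infimums_neq0 : forall E : set L, infimums E !=set0
}.

#[short(type="completeLatticeType")]
HB.structure Definition CompleteLattice d :=
  { L of TBLattice_isComplete d L & Order.TBLattice d L }.

(* The default value \bot only matters for E = set0, whose join is \bot. *)
Definition bigjoin d (L : completeLatticeType d) (E : set L) : L :=
  supremum \bot E.

(* The multiplicative identity 1 of the monoid and the greatest element \top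
   are a priori two constants, identified by one_top. *)
HB.mixin Record isMultLattice d L of CompleteLattice d L & Monoid L := {
  mul_comm : commutative (@mul L);
  one_top : 1%g = \top :> L;
  mul_bigjoinr : forall (x : L) (E : set L),
    (x * bigjoin E)%g = bigjoin [set (x * e)%g | e in E]
}.

#[short(type="multLatticeType")]
HB.structure Definition MultLattice d :=
  { L of isMultLattice d L & CompleteLattice d L & Monoid L }.

Section MultLatticeElements.
Context {d : Order.disp_t} {L : multLatticeType d}.
Implicit Types (a m p x : L) (C : set L).

Definition compact_elt a : Prop :=
  forall F : set L, a <= bigjoin F ->
    exists E : set L, [/\ finite_set E, E `<=` F & a <= bigjoin E].

Definition mult_closed C : Prop :=
  C 1%g /\ forall a b : L, C a -> C b -> C (a * b)%g.

Definition proper_elt a : Prop := a < 1%g.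

Definition maximal_elt m : Prop :=
  proper_elt m /\ forall x : L, m < x -> x <= 1%g -> x = 1%g.

Definition prime_elt p : Prop :=
  proper_elt p /\
  forall a b : L, (a * b)%g <= p -> a <= p \/ b <= p.

Definition OA_elt x : Prop :=
  proper_elt x /\
  forall a b c : L, a <> 1%g -> b <> 1%g -> c <> 1%g ->
    (a * b * c)%g <= x -> (a * b)%g <= x \/ c <= x.

Definition quasi_local m : Prop :=
  compact_elt (1%g : L) /\ unique maximal_elt m.

End MultLatticeElements.

Definition C_lattice d (L : multLatticeType d) : Prop :=
  exists C : set L,
    [/\ mult_closed C,
        forall c : L, C c -> compact_elt c &
        forall x : L, exists E : set L, E `<=` C /\ x = bigjoin E].

(* Main.v *)
Require Import Defs.
From mathcomp Require Import all_boot all_order.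
From mathcomp Require Import boolp classical_sets cardinality.

(** Since [1] is compact, Zorn's lemma puts every proper element below [m], so
    [a * b <= m ^+ 2] for proper [a] and [b]. Conversely, let [x] be a non-prime
    OA-element, say [a * b <= x] with [a] and [b] not below [x]. Then [a] and
    [b] are proper, and the OA property applied to [m * a * b <= x] yields
    [m * a <= x]; applied again to [m * m * a <= x], it yields [m * m <= x].
    Moreover [x] differs from [m], because [a <= m]. *)

Set Implicit Arguments.
Unset Strict Implicit.
Unset Printing Implicit Defensive.

Import Order.TTheory.
Local Open Scope classical_set_scope.
Local Open Scope order_scope.

(** Induction on a list enumerating [E]: the bound is the larger of the new entry [z] and the bound
    [w] of the rest. The member [y] serves for the empty list. *)
Lemma finite_chain_ub d (T : porderType d) (F E : set T) (y : T) :
  total_on F (fun u v => u <= v) -> F y -> finite_set E -> E `<=` F ->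
  exists2 w, F w & ubound E w.
Proof.
move=> totF Fy /finite_seqP[s ->]; elim: s => [|z s IHs] sF; first by exists y.
have [|w Fw ubw] := IHs.
  by move=> t /= ts; apply: sF; rewrite /= inE ts orbT.
have Fz : F z by apply: sF; rewrite /= mem_head.
have [zw|wz] := totF z w Fz Fw.
  by exists w => // t /=; rewrite inE => /predU1P[->//|/ubw].
exists z => // t /=; rewrite inE => /predU1P[->//|/ubw tw].
exact: le_trans tw wz.
Qed.

Section BigJoin.
Context {d : Order.disp_t} {L : completeLatticeType d}.
Implicit Types (E F : set L) (x y : L).

Lemma bigjoin_ub E : ubound E (bigjoin E).
Proof.
move=> x Ex; rewrite /bigjoin /supremum ifN; last by apply/set0P; exists x.
(* Completeness supplies a supremum, so [xget] cannot return its default. *)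
have [y Ey] := supremums_neq0 E.
by case: xgetP => [z _ [ubz _]|/(_ y)//]; exact: ubz.
Qed.

Lemma bigjoin_le E x : ubound E x -> bigjoin E <= x.
Proof.
move=> ubx; rewrite /bigjoin /supremum; case: ifPn => [_|_]; first exact: le0x.
have [y Ey] := supremums_neq0 E.
by case: xgetP => [z _ [_ lbz]|/(_ y)//]; exact: lbz.
Qed.

End BigJoin.

Section MultLatticeTheory.
Context {d : Order.disp_t} {L : multLatticeType d}.
Implicit Types (a b c m x y : L) (F : set L).

Lemma le_one x : x <= 1%g.
Proof. by rewrite one_top; exact: lex1. Qed.

Lemma proper_eltP x : proper_elt x <-> x <> 1%g.
Proof.
by rewrite /proper_elt lt_neqAle le_one andbT; split=> /eqP.
Qed.

(** Monotonicity comes from distributivity over the join of the pair [a], [b], which is [b]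
    itself. *)
Lemma mul_le2l c a b : a <= b -> (c * a <= c * b)%g.
Proof.
move=> ab.
have -> : b = bigjoin [set a; b].
  apply/le_anti/andP; split; first by apply: bigjoin_ub; right.
  by apply: bigjoin_le => z [->|->].
by rewrite mul_bigjoinr; apply: bigjoin_ub; exists a => //; left.
Qed.

Lemma mul_le2r c a b : a <= b -> (a * c <= b * c)%g.
Proof. by rewrite ![(_ * c)%g]mul_comm; exact: mul_le2l. Qed.

Lemma mul_le2 a b a' b' : a <= a' -> b <= b' -> (a * b <= a' * b')%g.
Proof. by move=> aa' bb'; exact: le_trans (mul_le2r _ aa') (mul_le2l _ bb'). Qed.

Lemma mul_ler a b : (a * b <= b)%g.
Proof. by rewrite -[leRHS]mul1g; exact/mul_le2r/le_one. Qed.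

(** If the join were [1], compactness would give a finite part of [F] with join [1]; a single member
    of the chain bounds that part and would not be proper. *)
Lemma bigjoin_chain_proper F y : compact_elt (1%g : L) ->
  total_on F (fun u v => u <= v) -> F y -> F `<=` proper_elt ->
  proper_elt (bigjoin F).
Proof.
move=> c1 totF Fy Fprop; apply/proper_eltP => F1.
have [|E [finE EF leE]] := c1 F; first by rewrite F1.
have [w Fw ubw] := finite_chain_ub totF Fy finE EF.
have := le_lt_trans (le_trans leE (bigjoin_le ubw)) (Fprop w Fw).
by rewrite ltxx.
Qed.

Lemma exists_maximal_ge y : compact_elt (1%g : L) -> proper_elt y ->
  exists2 n, maximal_elt n & y <= n.
Proof.
move=> c1 y1.
pose P z := (y <= z) && (z < 1%g); pose T := {z : L | P z}.
have Py : P y by rewrite /P lexx.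
have [| | |[n Pn] nmax] := @ZL_preorder T (exist P y Py)
    (fun s t => sval s <= sval t).
- by move=> t; exact: lexx.
- by move=> r s t; exact: le_trans.
(* Adjoining [y] makes the chain nonempty and keeps its join above [y], even when [A] is empty. *)
- move=> A totA; pose F := y |` [set sval t | t in A].
  have Pge (t : T) : y <= sval t by case/andP: (svalP t).
  have totF : total_on F (fun u v => u <= v).
    move=> _ _ [->|[s As <-]] [->|[t At <-]]; [by left|by left|by right|].
    exact: totA.
  have Fy : F y by left.
  have Fprop : F `<=` proper_elt.
    by move=> _ [->//|[t _ <-]]; case/andP: (svalP t).
  have PF : P (bigjoin F).
    apply/andP; split; first exact: bigjoin_ub.
    exact: bigjoin_chain_proper Fy Fprop.
  by exists (exist P _ PF) => t At; apply: bigjoin_ub; right; exists t.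
have /andP[yn n1] := Pn; exists n => //; split=> // z nz _.
(* A proper [z] above [n] would lie in [T], so the Zorn property [nmax] would force [z <= n]. *)
apply: contrapT => /proper_eltP z1.
have Pz : P z by rewrite /P (le_trans yn (ltW nz)).
by have /= := nmax (exist P z Pz) (ltW nz); rewrite lt_geF.
Qed.

Lemma quasi_local_le m y : quasi_local m -> proper_elt y -> y <= m.
Proof.
by move=> [c1 [_ mU]] /(exists_maximal_ge c1)[n /mU <-].
Qed.

Lemma prime_OA_elt x : prime_elt x -> OA_elt x.
Proof. by move=> [x1 xP]; split=> // a b c _ _ _; exact: xP. Qed.

Lemma OA_elt_nprime x a b y : OA_elt x ->
    (a * b <= x)%g -> ~ a <= x -> ~ b <= x -> proper_elt y ->
  (y * y <= x)%g.
Proof.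
move=> [x1 OA] abx ax bx /proper_eltP y1.
(* If one factor were [1], [abx] would put the other below [x]. *)
have a1 : a <> 1%g by move=> a1; apply: bx; rewrite -[b]mul1g -a1.
have b1 : b <> 1%g by move=> b1; apply: ax; rewrite -[a]mulg1 -b1.
have yabx : (y * a * b <= x)%g.
  by rewrite -mulgA; exact: le_trans (mul_ler _ _) abx.
have [yax|//] := OA y a b y1 a1 b1 yabx.
have yyax : (y * y * a <= x)%g.
  by rewrite -mulgA; exact: le_trans (mul_ler _ _) yax.
by have [|/ax] := OA y y a y1 y1 a1 yyax.
Qed.

End MultLatticeTheory.

Theorem proposition2p7 (d : Order.disp_t) (L : multLatticeType d) (m x : L)
  (hL : C_lattice L) (hm : quasi_local m) (hx : proper_elt x) :
  OA_elt x <-> prime_elt x \/ ((m ^+ 2)%g <= x < m)%O.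
Proof.
have m1 : proper_elt m by case: hm => _ [[]].
split=> [OAx|[|/andP[m2x _]]]; last 2 first.
- exact: prime_OA_elt.
- split=> // a b c a1 b1 _ _; left; apply: le_trans m2x; rewrite expg2.
  by apply: mul_le2; apply: (quasi_local_le hm); apply/proper_eltP.
have [|xNprime] := pselect (prime_elt x); first by left.
right; have [a [b [abx ax bx]]] :
    exists a b, [/\ (a * b <= x)%g, ~ a <= x & ~ b <= x].
  apply: contrapT => Nab; apply: xNprime; split=> // a b abx.
  have [|ax] := pselect (a <= x); first by left.
  by right; apply: contrapT => bx; apply: Nab; exists a, b.
rewrite expg2 (OA_elt_nprime OAx abx ax bx m1) lt_neqAle /=.
rewrite (quasi_local_le hm hx) andbT; apply/eqP => xm.
(* If [x = m], then [a], being proper, lies below [m = x], against [ax]. *)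
apply: ax; rewrite xm; apply: (quasi_local_le hm); apply/proper_eltP => a1.
by apply: bx; rewrite -[b]mul1g -a1.
Qed.
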